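(* Let $s\ge 2$, let $p_1,\dots,p_s\in(0,1]$ be distinct, let $a_1,\dots,a_s$ be positive integers and let $W>0$. Let $A=(n_{i,j})$ be an optimal solution, with $m$ classes, of the school problem with $s$ types of students. Then the bipartite graph $G(A)$ is a forest, and the number of mixed classes is at most $s-1$. Moreover, the number of mixed classes is exactly $s-1$ if and only if $G(\tilde A)$ is a path with $2(s-1)$ edges.
   Context: There are $s$ types of students, with $a_i$ students of type $i$; a student of type $i$ has probability $p_i$ of not disrupting the class. A feasible solution consists of a number of classes $m\ge1$ and an $s\times m$ matrix $(n_{i,j})$ of nonnegative integers with $\sum_{j=1}^m n_{i,j}=a_i$ for $1\le i\le s$, where $n_{i,j}$ is the number of students of type $i$ in class $j$. Its profit is $\sum_{j=1}^{m}\bigl(\sum_{i=1}^{s} n_{i,j}\bigr)\prod_{i=1}^{s}p_i^{n_{i,j}}-Wm$ (with the convention $p^0=1$). An optimal solution is a feasible solution of maximum profit over all $m$ and all such matrices. A class $j$ is mixed if it contains students of more than one type, i.e. $n_{i,j}>0$ for at least two values of $i$. For an $s\times m$ nonnegative matrix $A=(n_{i,j})$, $G(A)$ is the bipartite graph with row nodes $1,\dots,s$, column nodes $1,\dots,m$, and an edge joining row node $i$ and column node $j$ exactly when $n_{i,j}>0$. $\tilde A$ is the submatrix of $A$ formed by all rows $1,\dots,s$ and the columns corresponding to mixed classes, and $G(\tilde A)$ is the corresponding bipartite graph (with all $s$ row nodes). *)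

(* Defs.v *)
From HB Require Import structures.
From mathcomp Require Import all_boot all_order all_algebra.
From mathcomp Require Import reals.

Set Implicit Arguments.
Unset Strict Implicit.
Unset Printing Implicit Defensive.

Import Order.TTheory GRing.Theory Num.Theory.
Local Open Scope ring_scope.

Definition feasible (s : nat) (a : 'I_s -> nat) (m : nat)
    (A : 'M[nat]_(s, m)) : Prop :=
  (1 <= m)%N /\ forall i : 'I_s, (\sum_(j < m) A i j)%N = a i.

Definition profit (R : realType) (s : nat) (p : 'I_s -> R) (W : R) (m : nat)
    (A : 'M[nat]_(s, m)) : R :=
  (\sum_(j < m) (\sum_(i < s) A i j)%N%:R * \prod_(i < s) p i ^+ A i j)
  - W * m%:R.

Definition optimal (R : realType) (s : nat) (p : 'I_s -> R) (a : 'I_s -> nat)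
    (W : R) (m : nat) (A : 'M[nat]_(s, m)) : Prop :=
  feasible a A /\
  forall (m' : nat) (A' : 'M[nat]_(s, m')),
    feasible a A' -> profit p W A' <= profit p W A.

Definition mixed_classes (s m : nat) (A : 'M[nat]_(s, m)) : {set 'I_m} :=
  [set j | (1 < #|[set i | 0 < A i j]|)%N].

(* All rows are kept; the mixed columns are kept in their original order. *)
Definition mixed_submx (s m : nat) (A : 'M[nat]_(s, m)) :
    'M[nat]_(s, #|mixed_classes A|) :=
  colsub (fun k : 'I_#|mixed_classes A| => enum_val k) A.

(* Row nodes are the [inl i], column nodes the [inr j]. *)
Definition bigraph (s m : nat) (A : 'M[nat]_(s, m)) : rel ('I_s + 'I_m) :=
  fun u v => match u, v with
             | inl i, inr j | inr j, inl i => (0 < A i j)%N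
             | _, _ => false
             end.

(* For a simple graph given by its adjacency relation.  Cycles have at least
   three nodes: in a symmetric relation, [ucycle] also accepts [:: x; y]. *)
Definition is_forest (V : finType) (e : rel V) : Prop :=
  forall c : seq V, (2 < size c)%N -> ~ ucycle e c.

(* The whole graph is a path: [c] lists every node exactly once, and two nodes
   are adjacent exactly when they are consecutive in [c]. *)
Definition is_path_with_edges (V : finType) (e : rel V) (l : nat) : Prop :=
  exists c : seq V,
    [/\ uniq c, forall v, v \in c, size c = l.+1
      & forall u v, e u v =
          ((index v c == (index u c).+1) || (index u c == (index v c).+1))].

(* Main.v *)
Require Import Defs.
From HB Require Import structures.
From mathcomp Require Import all_boot all_order all_algebra.
From mathcomp Require Import reals.
From mathcomp Require Import zify ring.

Set Implicit Arguments.
Unset Strict Implicit.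
Unset Printing Implicit Defensive.

Import Order.TTheory GRing.Theory Num.Theory.
Local Open Scope ring_scope.

(** Only one kind of move is needed: exchanging a student of one class with a
student of another.  Call [N * P] the value of a class with [N] students and
product of probabilities [P].  Exchanging a student of probability [q] of a
class of value [u] with one of probability [q'] of a class of value [v] keeps
both sizes and the number of classes, and turns the values into [u * q' / q]
and [v * q / q'].  If [q' < q] and the exchange brings no gain, then
[v <= u * q' / q < u]: in an optimal solution, a class holding a better student
than some student of another class is worth strictly more
([better_student_better_class]).  Hence, for two distinct classes, it cannot
happen that each holds a student better than some student of the other
([optimal_noncrossing]).

Order the types by probability.  The classes then occupy intervals of types
that overlap at most at their endpoints, and everything else is combinatorics
of such intervals.

- Forest: on a cycle of the graph, the two neighbours of the highest row are
  distinct classes that both hold this type and a lower one, which makes them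
  cross ([noncrossing_forest]).
- Counting: for the same reason, distinct mixed classes have distinct highest
  types, and the lowest type of all is not among these; so there are at most
  [s - 1] mixed classes ([card_noncrossing_mixed]).
- Equality: every type except the lowest is then the highest of some mixed
  class.  A type strictly inside the interval of a mixed class would head
  another mixed class, crossing the first; so a mixed class holds exactly two
  types, consecutive in the order ([consecutive_types]), and the graph is the
  path that alternates the types in order with the classes joining them
  ([noncrossing_path]).  Conversely a spanning path with [2 * (s - 1)] edges has
  [2 * s - 1] nodes, [s] of which are rows. *)

(** * Exchanging two students *)

Definition replace_student (s : nat) (n : 'I_s -> nat) (x y : 'I_s) (i : 'I_s) :
    nat :=
  (n i + (i == y) - (i == x))%N.

Definition class_value (R : realType) (s : nat) (p : 'I_s -> R)
    (n : 'I_s -> nat) : R :=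
  (\sum_(i < s) n i)%N%:R * \prod_(i < s) p i ^+ n i.

(** Addition form of the definition: it lets sums and products over the class
be compared without truncated subtraction. *)
Lemma replace_studentK (s : nat) (n : 'I_s -> nat) (x y i : 'I_s) :
  (0 < n x)%N ->
  (replace_student n x y i + (i == x) = n i + (i == y))%N.
Proof.
rewrite /replace_student => nx; apply: subnK.
by case: (i =P x) => // ->; rewrite ltn_addr.
Qed.

Lemma class_value_gt0 (R : realType) (s : nat) (p : 'I_s -> R)
    (n : 'I_s -> nat) (x : 'I_s) :
  (forall i, 0 < p i) -> (0 < n x)%N -> 0 < class_value p n.
Proof.
move=> p_gt0 nx; rewrite mulr_gt0 ?prodr_gt0 // => [|i _]; last exact: exprn_gt0.
by rewrite ltr0n (bigD1 x) //= ltn_addr.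
Qed.

Lemma class_value_replace (R : realType) (s : nat) (p : 'I_s -> R)
    (n : 'I_s -> nat) (x y : 'I_s) :
  (0 < n x)%N ->
  class_value p (replace_student n x y) * p x = class_value p n * p y.
Proof.
move=> nx; have sum1 z : (\sum_(i < s) (i == z :> 'I_s) = 1)%N.
  by rewrite (bigD1 z) //= eqxx big1 // => i /negPf ->.
have prod1 z : \prod_(i < s) p i ^+ (i == z) = p z.
  by rewrite (bigD1 z) //= eqxx big1 ?mulr1 // => i /negPf ->.
have same_size : (\sum_(i < s) replace_student n x y i = \sum_(i < s) n i)%N.
  have : (\sum_(i < s) (replace_student n x y i + (i == x)) =
          \sum_(i < s) (n i + (i == y)))%N.
    by apply: eq_bigr => i _; rewrite replace_studentK.
  by rewrite !big_split /= !sum1 => /addIn.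
rewrite /class_value same_size -!mulrA; congr (_ * _).
rewrite -[X in _ * X = _](prod1 x) -[X in _ = _ * X](prod1 y) -!big_split /=.
by apply: eq_bigr => i _; rewrite -!exprD replace_studentK.
Qed.

Definition swap_students (s m : nat) (A : 'M[nat]_(s, m)) (j k : 'I_m)
    (x y : 'I_s) : 'M[nat]_(s, m) :=
  \matrix_(i, l) if l == j then replace_student (A^~ j) x y i
                 else if l == k then replace_student (A^~ k) y x i
                 else A i l.

Lemma swap_students_feasible (s : nat) (a : 'I_s -> nat) (m : nat)
    (A : 'M[nat]_(s, m)) (j k : 'I_m) (x y : 'I_s) :
  j != k -> (0 < A x j)%N -> (0 < A y k)%N -> feasible a A ->
  feasible a (swap_students A j k x y).
Proof.
move=> neq_jk xj yk [m_gt0 rowsA]; split=> // i; rewrite -rowsA.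
rewrite (bigD1 j) // (bigD1 k) 1?eq_sym //= [RHS](bigD1 j) //=.
rewrite [in RHS](bigD1 k) 1?eq_sym //= !mxE eqxx (eq_sym k) (negPf neq_jk) eqxx.
rewrite !addnA; congr (_ + _)%N; last first.
  by apply: eq_bigr => l /andP[/negPf lj /negPf lk]; rewrite mxE lj lk.
have := replace_studentK (n := A^~ j) y i xj.
have := replace_studentK (n := A^~ k) x i yk.
by lia.
Qed.

Lemma profit_swap_students (R : realType) (s : nat) (p : 'I_s -> R) (W : R)
    (m : nat) (A : 'M[nat]_(s, m)) (j k : 'I_m) (x y : 'I_s) :
  j != k ->
  profit p W (swap_students A j k x y) - profit p W A =
  class_value p (replace_student (A^~ j) x y)
  + class_value p (replace_student (A^~ k) y x)
  - (class_value p (A^~ j) + class_value p (A^~ k)).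
Proof.
move=> neq_jk; have profitE (B : 'M[nat]_(s, m)) : profit p W B =
    \sum_l class_value p (B^~ l) - W * m%:R by [].
have classE l n : (swap_students A j k x y)^~ l =1 n ->
    class_value p ((swap_students A j k x y)^~ l) = class_value p n.
  move=> eq_n; rewrite /class_value (eq_bigr n) => [|i _]; last exact: eq_n.
  by congr (_ * _); apply: eq_bigr => i _; rewrite eq_n.
rewrite !profitE opprB addrA subrK.
have split_jk (F : 'I_m -> R) :
    \sum_l F l = F j + F k + \sum_(l | (l != j) && (l != k)) F l.
  by rewrite (bigD1 j) //= (bigD1 k) 1?eq_sym //= addrA.
rewrite !split_jk.
rewrite (classE j (replace_student (A^~ j) x y)); last first.
  by move=> i; rewrite mxE eqxx.
rewrite (classE k (replace_student (A^~ k) y x)); last first.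
  by move=> i; rewrite mxE (eq_sym k) (negPf neq_jk) eqxx.
rewrite (eq_bigr (fun l => class_value p (A^~ l))); last first.
  by move=> l /andP[/negPf lj /negPf lk]; apply: classE => i; rewrite mxE lj lk.
by ring.
Qed.

(** The exchange of [x] and [y] brings no gain.  Writing [u], [v] for the values
of [j] and [k], the gain times [p x * p y] factors as
[(p x - p y) * (v * p x - u * p y)], so [v * p x <= u * p y < u * p x]. *)
Lemma better_student_better_class (R : realType) (s : nat) (p : 'I_s -> R)
    (a : 'I_s -> nat) (W : R) (m : nat) (A : 'M[nat]_(s, m)) (j k : 'I_m)
    (x y : 'I_s) :
  (forall i, 0 < p i) -> optimal p a W A -> j != k ->
  (0 < A x j)%N -> (0 < A y k)%N -> p y < p x ->
  class_value p (A^~ k) < class_value p (A^~ j).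
Proof.
move=> p_gt0 [feasA maxA] neq_jk xj yk lt_yx.
have := maxA _ _ (swap_students_feasible neq_jk xj yk feasA).
rewrite -subr_le0 profit_swap_students //.
have := class_value_replace p (n := A^~ j) y xj.
have := class_value_replace p (n := A^~ k) x yk.
have := class_value_gt0 p_gt0 (n := A^~ j) xj.
have := p_gt0 x; have := p_gt0 y.
set u := class_value p (A^~ j); set v := class_value p (A^~ k).
set v' := class_value _ (replace_student _ y x).
set u' := class_value _ (replace_student _ x y).
move=> y_gt0 x_gt0 u_gt0 v'E u'E loss.
have v_le : v * p x <= u * p y.
  rewrite -subr_le0 -(pmulr_rle0 _ (_ : 0 < p x - p y)) ?subr_gt0 //.
  have -> : (p x - p y) * (v * p x - u * p y) =
      (u' * p x) * p y + (v' * p y) * p x - (u + v) * (p x * p y).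
    by rewrite u'E v'E; ring.
  have -> : (u' * p x) * p y + (v' * p y) * p x - (u + v) * (p x * p y) =
      (p x * p y) * (u' + v' - (u + v)) by ring.
  by rewrite pmulr_rle0 ?mulr_gt0.
rewrite -(ltr_pM2r x_gt0); apply: le_lt_trans v_le _.
by rewrite ltr_pM2l.
Qed.

(** * Classes as noncrossing intervals of types *)

(** Two classes cross when each of them holds a type above some type of the
other.  The witnesses [x], [x'] of the class [j] may coincide, and so may [y],
[y']; hence two distinct noncrossing classes can share a type only as the
highest of one and the lowest of the other. *)
Definition noncrossing (s m : nat) (r : 'I_s -> 'I_s) (A : 'M[nat]_(s, m)) :=
  forall (j k : 'I_m) (x x' y y' : 'I_s),
    (0 < A x j)%N -> (0 < A x' j)%N -> (0 < A y k)%N -> (0 < A y' k)%N ->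
    (r x < r y)%N -> (r y' < r x')%N -> j = k.

Lemma card_lt_rank (R : realType) (s : nat) (p : 'I_s -> R) (i : 'I_s) :
  (#|[set x | (p x < p i)%R]| < s)%N.
Proof.
rewrite -[X in (_ < X)%N]card_ord -cardsT; apply: proper_card; apply/properP.
by split; [apply: subsetT|exists i; rewrite !inE // ltxx].
Qed.

(** Only the order of the probabilities matters from here on.  Ranks are taken
in ['I_s], so that an injective [r] is onto and every rank is that of a type. *)
Definition rank (R : realType) (s : nat) (p : 'I_s -> R) (i : 'I_s) : 'I_s :=
  Ordinal (card_lt_rank p i).

Lemma ltn_rank (R : realType) (s : nat) (p : 'I_s -> R) (x y : 'I_s) :
  (rank p x < rank p y)%N = (p x < p y).
Proof.
case: (ltP (p x) (p y)) => [lt_xy|le_yx] /=.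
  apply: proper_card; apply/properP; split.
    by apply/subsetP => z; rewrite !inE => /lt_trans; apply.
  by exists x; rewrite !inE // ltxx.
apply/negbTE; rewrite -leqNgt; apply: subset_leq_card.
by apply/subsetP => z; rewrite !inE => /lt_le_trans; apply.
Qed.

Lemma rank_inj (R : realType) (s : nat) (p : 'I_s -> R) :
  injective p -> injective (rank p).
Proof.
move=> p_inj x y eq_xy; apply: p_inj; apply/eqP.
by rewrite eq_le !leNgt -!ltn_rank eq_xy ltnn.
Qed.

(** If two classes crossed, each would be worth strictly more than the other. *)
Lemma optimal_noncrossing (R : realType) (s : nat) (p : 'I_s -> R)
    (a : 'I_s -> nat) (W : R) (m : nat) (A : 'M[nat]_(s, m)) :
  (forall i, 0 < p i) -> optimal p a W A -> noncrossing (rank p) A.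
Proof.
move=> p_gt0 optA j k x x' y y' xj x'j yk y'k; rewrite !ltn_rank => lt_xy lt_yx.
apply/eqP; apply/negPn/negP => neq_jk.
have := better_student_better_class p_gt0 optA neq_jk x'j y'k lt_yx.
rewrite eq_sym in neq_jk.
by rewrite ltNge ltW // (better_student_better_class p_gt0 optA neq_jk yk xj).
Qed.

(** * Cycles *)

(** If both neighbours of [v] were the same, two steps forward from [v] would
lead back to [v], which closes the cycle after two nodes. *)
Lemma next_neq_prev (V : eqType) (c : seq V) (v : V) :
  uniq c -> (2 < size c)%N -> v \in c -> next c v != prev c v.
Proof.
move=> uniq_c size_c /rot_to[i c' rot_c].
suff : next c (next c v) != v by apply: contraNneq => ->; rewrite next_prev.
rewrite -!(next_rot i uniq_c) rot_c.
move: uniq_c size_c; rewrite -(rot_uniq i) -(size_rot i) rot_c.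
case: c' {rot_c} => [|y [|z c']] //= /andP[].
rewrite !inE !negb_or !eqxx => /and3P[v_y v_z _] _ _.
by rewrite (eq_sym y) (negPf v_y) eq_sym.
Qed.

(** Both neighbours of the highest row [i] of a cycle are columns that contain
[i] and, as their other neighbour in the cycle, a row lower than [i]. *)
Lemma noncrossing_forest (s m : nat) (r : 'I_s -> 'I_s) (A : 'M[nat]_(s, m)) :
  injective r -> noncrossing r A -> is_forest (bigraph A).
Proof.
move=> r_inj nc c size_c /andP[cyc_c uniq_c].
have nextE v : v \in c -> bigraph A v (next c v) by apply: next_cycle.
have prevE v : v \in c -> bigraph A (prev c v) v by apply: prev_cycle.
have neq v := next_neq_prev (v := v) uniq_c size_c.
have [i0 i0c] : exists i, inl i \in c.
  case: c size_c {cyc_c uniq_c neq prevE} nextE => // [[i|j] c] _ nextE.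
    by exists i; rewrite mem_head.
  have := nextE _ (mem_head _ _); have := mem_next (inr j :: c) (inr j).
  rewrite mem_head; case: (next _ _) => // i ic _; by exists i.
case: (arg_maxnP (P := fun i => inl i \in c) (fun i => r i : nat) i0c) => i ic imax.
have lower x : inl x \in c -> x != i -> (r x < r i)%N.
  move=> xc xi; rewrite ltn_neqAle [X in _ && X](imax x xc) andbT.
  by apply: contra xi => /eqP/val_inj/r_inj ->.
have := nextE _ ic; case En: (next c (inl i)) => [//|j] /= ij.
have := prevE _ ic; case Ep: (prev c (inl i)) => [//|k] /= ik.
have jc : inr j \in c by rewrite -En mem_next.
have kc : inr k \in c by rewrite -Ep mem_prev.
have := neq _ ic; rewrite En Ep => /eqP; apply; congr inr.
have jprev : prev c (inr j) = inl i by rewrite -En prev_next.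
have knext : next c (inr k) = inl i by rewrite -Ep next_prev.
have := nextE _ jc; case Ej: (next c (inr j)) => [x|//] /= xj.
have := prevE _ kc; case Ek: (prev c (inr k)) => [y|//] /= yk.
have xi : x != i.
  by have := neq _ jc; rewrite jprev Ej; apply: contraNneq => ->.
have yi : y != i.
  by have := neq _ kc; rewrite knext Ek eq_sym; apply: contraNneq => ->.
apply: (nc j k x i i y) => //; apply: lower => //.
  by rewrite -Ej mem_next.
by rewrite -Ek mem_prev.
Qed.

(** * Highest types of mixed classes *)

Definition all_mixed (s m : nat) (A : 'M[nat]_(s, m)) : Prop :=
  forall j, (1 < #|[set i | 0 < A i j]|)%N.

(** The last clause is automatic in a mixed class when [r] is injective; it is the
lower type that makes two classes with the same highest type cross. *)
Definition is_top (s m : nat) (r : 'I_s -> 'I_s) (A : 'M[nat]_(s, m))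
    (t : 'I_s) (j : 'I_m) : Prop :=
  [/\ (0 < A t j)%N,
      forall i, (0 < A i j)%N -> (r i <= r t)%N
    & exists2 b, (0 < A b j)%N & (r b < r t)%N].

Lemma exists_top (s m : nat) (r : 'I_s -> 'I_s) (A : 'M[nat]_(s, m)) :
  injective r -> all_mixed A ->
  exists top : 'I_m -> 'I_s, forall j, is_top r A (top j) j.
Proof.
move=> r_inj mixA.
apply: (@fin_all_exists _ (fun=> 'I_s) (fun j t => is_top r A t j)) => j.
have /card_gt1P[x [y]] := mixA j; rewrite !inE => -[xj yj neq_xy].
case: (arg_maxnP (P := fun i => 0 < A i j)%N (fun i => r i : nat) xj) => t tj tmax.
exists t; split=> //.
suff [b bj neq_bt] : exists2 b, (0 < A b j)%N & b != t.
  exists b => //; rewrite ltn_neqAle [X in _ && X]tmax // andbT.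
  by apply: contra neq_bt => /eqP/val_inj/r_inj ->.
by have [xt|] := eqVneq x t; [exists y; rewrite // -xt eq_sym | exists x].
Qed.

Lemma top_inj (s m : nat) (r : 'I_s -> 'I_s) (A : 'M[nat]_(s, m))
    (top : 'I_m -> 'I_s) :
  noncrossing r A -> (forall j, is_top r A (top j) j) -> injective top.
Proof.
move=> nc topP j k eq_jk.
have [tj _ [b bj lt_bj]] := topP j; have [tk _ [b' b'k lt_bk]] := topP k.
by apply: (nc j k b (top j) (top k) b'); rewrite // ?eq_jk // -eq_jk.
Qed.

(** The highest types are distinct and never the type of rank zero. *)
Lemma card_noncrossing_mixed (s m : nat) (r : 'I_s -> 'I_s)
    (A : 'M[nat]_(s, m)) :
  (0 < s)%N -> injective r -> noncrossing r A -> all_mixed A -> (m <= s - 1)%N.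
Proof.
case: s r A => // s r A _ r_inj nc mixA; rewrite subn1 /=.
have [top topP] := exists_top r_inj mixA.
have t_inj := top_inj nc topP.
have [g gK rK] := injF_bij r_inj.
have : (#|codom top| <= #|predC1 (g ord0)|)%N.
  apply: subset_leq_card; apply/subsetP => _ /codomP[j ->]; rewrite inE.
  have [_ _ [b _ lt_b]] := topP j; apply: contraTneq lt_b => ->.
  by rewrite rK.
by rewrite card_codom // card_ord cardC1 card_ord.
Qed.

(** There are as many classes as types of nonzero rank, so the injective map to
the highest type is onto these. *)
Lemma every_type_top (s m : nat) (r : 'I_s -> 'I_s) (A : 'M[nat]_(s, m))
    (top : 'I_m -> 'I_s) (t : 'I_s) :
  m = (s - 1)%N -> injective r -> noncrossing r A ->
  (forall j, is_top r A (top j) j) -> (0 < r t)%N -> exists j, top j = t.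
Proof.
case: s r A top t => [|s] r A top t; first by case: t.
rewrite subn1 /= => m_eq r_inj nc topP t_gt0.
have t_inj := top_inj nc topP.
have [g gK rK] := injF_bij r_inj.
have sub : codom top \subset predC1 (g ord0).
  apply/subsetP => _ /codomP[j ->]; rewrite inE.
  have [_ _ [b _ lt_b]] := topP j; apply: contraTneq lt_b => ->.
  by rewrite rK.
have card_eq : #|codom top| = #|predC1 (g ord0)|.
  by rewrite card_codom // cardC1 !card_ord.
have /codomP[j ->] : t \in codom top; last by exists j.
rewrite (subset_cardP card_eq sub) inE.
by apply: contraTneq t_gt0 => ->; rewrite rK.
Qed.

(** A gap between the highest type of [j] and another of its types would contain
a type [z], whether held by [j] or not.  Being the highest of a class [k], it
would make [j] and [k] cross, since [j] holds types on both sides of [z]. *)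
Lemma consecutive_types (s m : nat) (r : 'I_s -> 'I_s) (A : 'M[nat]_(s, m))
    (top : 'I_m -> 'I_s) (i : 'I_s) (j : 'I_m) :
  m = (s - 1)%N -> injective r -> noncrossing r A ->
  (forall j, is_top r A (top j) j) ->
  (0 < A i j)%N = (r i == r (top j)) || ((r i).+1 == r (top j) :> nat).
Proof.
move=> m_eq r_inj nc topP.
have [tj tmax [b bj lt_b]] := topP j.
have [g gK rK] := injF_bij r_inj.
have below x : (0 < A x j)%N -> (r x < r (top j))%N -> (r x).+1 = r (top j).
  move=> xj lt_x; apply/eqP; rewrite eqn_leq lt_x leqNgt; apply/negP => gap.
  (* It suffices to take for z the type just above x. *)
  have mid_lt : ((r x).+1 < s)%N by apply: ltn_trans gap (ltn_ord _).
  pose z := g (Ordinal mid_lt); have zE : r z = (r x).+1 :> nat by rewrite rK.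
  have [|k kz] := every_type_top (t := z) m_eq r_inj nc topP; first by rewrite zE.
  have [zk _ _] := topP k; rewrite kz in zk.
  have jk : j = k by apply: (nc j k x (top j) z z); rewrite // zE.
  by move: gap; rewrite jk kz zE ltnn.
apply/idP/orP => [ij|[/eqP/r_inj -> //|/eqP i_eq]].
  have [eq_it|neq_it] := eqVneq (r i) (r (top j)); first by left.
  by right; apply/eqP/below; rewrite // ltn_neqAle neq_it tmax.
suff -> : i = b by [].
by apply/r_inj/val_inj/succn_inj; rewrite /= i_eq below.
Qed.

(** * The spanning path *)

(** Numbering the nodes so that adjacency means consecutive numbers is the same
as listing them along a path, since the numbering is a bijection. *)
Lemma path_of_positions (V : finType) (e : rel V) (l : nat) (pos : V -> nat) :
  #|V| = l.+1 -> injective pos -> (forall v, pos v < l.+1)%N ->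
  (forall u v, e u v = (pos v == (pos u).+1) || (pos u == (pos v).+1)) ->
  is_path_with_edges e l.
Proof.
move=> cardV pos_inj pos_lt eE.
pose f v := Ordinal (pos_lt v).
have f_inj : injective f by move=> u v [/pos_inj].
have [|g gK fK] := inj_card_bij f_inj; first by rewrite card_ord cardV.
have idx v : index v [seq g o | o <- enum 'I_l.+1] = pos v.
  by rewrite -{1}[v]gK index_map ?index_enum_ord //; apply: can_inj fK.
exists [seq g o | o <- enum 'I_l.+1]; split.
- by rewrite map_inj_uniq ?enum_uniq //; apply: can_inj fK.
- by move=> v; rewrite -[v]gK map_f // mem_enum.
- by rewrite size_map size_enum_ord.
- by move=> u v; rewrite eE !idx.
Qed.

(** The type of rank [k] gets the even position [2 * k], and the class whose
highest type has rank [k] gets [2 * k - 1], between its two types. *)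
Lemma noncrossing_path (s m : nat) (r : 'I_s -> 'I_s) (A : 'M[nat]_(s, m)) :
  (0 < s)%N -> m = (s - 1)%N -> injective r -> noncrossing r A -> all_mixed A ->
  is_path_with_edges (bigraph A) (2 * (s - 1)).
Proof.
move=> s_gt0 m_eq r_inj nc mixA.
have [top topP] := exists_top r_inj mixA.
have t_inj := top_inj nc topP.
have edge i j := consecutive_types i j m_eq r_inj nc topP.
have top_gt0 j : (0 < r (top j))%N.
  by have [_ _ [b _ /(leq_ltn_trans _)->]] := topP j.
pose pos (v : 'I_s + 'I_m) : nat :=
  match v with inl i => (r i).*2 | inr j => (r (top j)).*2.-1 end.
apply: (path_of_positions (pos := pos)).
- by rewrite card_sum !card_ord m_eq; lia.
- move=> [x|j] [y|k] /= eq_pos.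
  + by congr inl; apply/r_inj/val_inj => /=; lia.
  + by have := top_gt0 k; lia.
  + by have := top_gt0 j; lia.
  + congr inr; apply/t_inj/r_inj/val_inj => /=.
    by have := top_gt0 j; have := top_gt0 k; lia.
- move=> [x|j] /=; first by have := ltn_ord (r x); lia.
  by have := ltn_ord (r (top j)); lia.
- move=> [x|j] [y|k] /=; rewrite ?edge; try lia.
  + by rewrite -val_eqE /=; have := top_gt0 k; lia.
  + by rewrite -val_eqE /=; have := top_gt0 j; lia.
  + by have := top_gt0 j; have := top_gt0 k; lia.
Qed.

(** * The submatrix of mixed classes *)

Lemma all_mixed_submx (s m : nat) (A : 'M[nat]_(s, m)) :
  all_mixed (mixed_submx A).
Proof.
move=> k; have := enum_valP k; rewrite inE.
by congr (1 < _)%N; apply: eq_card => i; rewrite !inE mxE.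
Qed.

Lemma noncrossing_submx (s m : nat) (r : 'I_s -> 'I_s) (A : 'M[nat]_(s, m)) :
  noncrossing r A -> noncrossing r (mixed_submx A).
Proof.
move=> nc j k x x' y y'; rewrite !mxE => xj x'j yk y'k lt_xy lt_yx.
by apply: enum_val_inj; apply: nc lt_xy lt_yx.
Qed.

Lemma size_spanning_path (V : finType) (e : rel V) (l : nat) :
  is_path_with_edges e l -> #|V| = l.+1.
Proof.
move=> [c [uniq_c all_c <- _]]; rewrite -(card_uniqP uniq_c).
by apply: eq_card => v; rewrite all_c.
Qed.

Theorem theorem32 (R : realType) (s : nat) (p : 'I_s -> R) (a : 'I_s -> nat)
    (W : R) (m : nat) (A : 'M[nat]_(s, m))
    (hs : (2 <= s)%N)
    (hp : forall i, 0 < p i <= 1)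
    (hp_distinct : injective p)
    (ha : forall i, (0 < a i)%N)
    (hW : 0 < W)
    (hA : optimal p a W A) :
  [/\ is_forest (bigraph A),
      (#|mixed_classes A| <= s - 1)%N
    & #|mixed_classes A| = (s - 1)%N <->
      is_path_with_edges (bigraph (mixed_submx A)) (2 * (s - 1))].
Proof.
have p_gt0 i : 0 < p i by case/andP: (hp i).
have s_gt0 : (0 < s)%N by apply: ltnW.
have r_inj := rank_inj hp_distinct.
have nc := optimal_noncrossing p_gt0 hA.
have nc' := noncrossing_submx nc; have mix' := @all_mixed_submx _ _ A.
split.
- exact: noncrossing_forest nc.
- exact: card_noncrossing_mixed nc' mix'.
- split=> [eq_m|/size_spanning_path]; first exact: noncrossing_path nc' mix'.
  by rewrite card_sum !card_ord; lia.
Qed.
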